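(* Let $T=(T_1,\dots,T_n)$ be a weighted shift on $\mathcal{H}_n$ with weights $\Lambda=\{\lambda_{i,w}\}$ and weight function $W$. If $$\sup_{1\le i\le n,\ w\in\mathbb{F}_n^+} W(i,w)\,W(e,w)^{-1}<\infty ,$$ then the commutant of $\mathfrak{L}_\Lambda$ in $\mathcal{B}(\mathcal{H}_n)$ is $\mathfrak{L}_\Lambda'=\mathfrak{R}_\Lambda$.
   Context: Let $n\ge 2$ and let $\mathbb{F}_n^+$ be the unital free semigroup on $n$ noncommuting letters $\{1,\dots,n\}$, with unit $e$ (the empty word). Fock space is $\mathcal{H}_n=\ell^2(\mathbb{F}_n^+)$ with orthonormal basis $\{\xi_w: w\in\mathbb{F}_n^+\}$. A weighted shift on $\mathcal{H}_n$ with weights $\Lambda=\{\lambda_{i,w}: 1\le i\le n,\ w\in\mathbb{F}_n^+\}$ is an $n$-tuple $T=(T_1,\dots,T_n)$ of bounded operators on $\mathcal{H}_n$ with $T_i\xi_w=\lambda_{i,w}\xi_{iw}$ for all $i,w$; throughout, all $\lambda_{i,w}>0$ (and $\sup_{i,w}\lambda_{i,w}<\infty$ by boundedness). $\mathfrak{L}_\Lambda$ denotes the unital weak-operator-topology (WOT) closed algebra generated by $\{T_1,\dots,T_n\}$. The weight function $W:\mathbb{F}_n^+\times\mathbb{F}_n^+\to\mathbb{R}_+$ is $W(u,e)=1$ and $W(u,w)=\lambda_{i_1,u}\lambda_{i_2,i_1u}\cdots\lambda_{i_k,i_{k-1}\cdots i_1u}$ for $w=i_k\cdots i_1$. When $\sup_{i,w}W(i,w)W(e,w)^{-1}<\infty$,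 let $S_i\in\mathcal{B}(\mathcal{H}_n)$ be defined by $S_i\xi_w=\mu_{i,w}\xi_{wi}$ with $\mu_{i,w}=W(i,w)W(e,w)^{-1}$, and let $\mathfrak{R}_\Lambda$ be the unital WOT-closed algebra generated by $\{S_1,\dots,S_n\}$. *)

(* Defs.v *)
From HB Require Import structures.
From mathcomp Require Import all_boot all_order all_algebra complex.
From mathcomp Require Import all_classical all_reals all_analysis.
From mathcomp Require Import ring lra.
From mathcomp Require summability.
Import numFieldNormedType.Exports.

Set Implicit Arguments.
Unset Strict Implicit.
Unset Printing Implicit Defensive.

Import Order.TTheory GRing.Theory Num.Theory.
Import ComplexField.Normc.

Local Open Scope classical_set_scope.
Local Open Scope complex_scope.
Local Open Scope ring_scope.

Section SquareSums.
Context (R : realType) (I : choiceType).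
Implicit Types x y : I -> R[i].

Definition square_sum x : \bar R :=
  \esum_(k in [set: I]) (normc (x k) ^+ 2)%:E.

Definition square_summable x : bool := (square_sum x < +oo)%E.

Lemma square_sum_ge0 x : (0 <= square_sum x)%E.
Proof. by apply: esum_ge0 => k _; rewrite lee_fin sqr_ge0. Qed.

Lemma square_sum0 : square_sum 0 = 0%E.
Proof. by apply: esum1 => k _; rewrite normc0 expr0n. Qed.

Lemma le_esumZ (c : R) (f : I -> R) : 0 <= c -> (forall k, 0 <= f k) ->
  (\esum_(k in [set: I]) (c * f k)%:E <=
   c%:E * \esum_(k in [set: I]) (f k)%:E)%E.
Proof.
move=> c0 f0; apply: ge_ereal_sup => _ [F [finF _] <-].
under eq_fsbigr do rewrite EFinM.
rewrite -ge0_mule_fsumr; last by move=> k; rewrite lee_fin.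
apply: lee_wpmul2l; first by rewrite lee_fin.
by apply: ereal_sup_ubound; exists F.
Qed.

Lemma normc_ge0 (z : R[i]) : 0 <= normc z.
Proof. by case: z => a b; exact: sqrtr_ge0. Qed.

Lemma le_sqr_sum (t p q : R) : 0 <= t -> t <= p + q ->
  t ^+ 2 <= 2 * p ^+ 2 + 2 * q ^+ 2.
Proof.
move=> t0 tpq; apply: (@le_trans _ _ ((p + q) ^+ 2)).
  by rewrite ler_pXn2r ?nnegrE ?(le_trans t0).
by rewrite -subr_ge0 [leRHS](_ : _ = (p - q) ^+ 2) ?sqr_ge0//; ring.
Qed.

Lemma square_sum_lin (a : R[i]) x y : (square_sum (a *: x + y)%R <=
  (2 * normc a ^+ 2)%:E * square_sum x + 2%:E * square_sum y)%E.
Proof.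
apply: (@le_trans _ _ (\esum_(k in [set: I])
    ((2 * normc a ^+ 2 * normc (x k) ^+ 2)%:E
     + (2 * normc (y k) ^+ 2)%:E))%E).
  apply: le_esum => k _; rewrite -EFinD lee_fin.
  have -> : (a *: x + y) k = a * x k + y k by [].
  have le1 : normc (a * x k + y k) <= normc a * normc (x k) + normc (y k).
    by rewrite -normcM; exact: le_normcD.
  have -> : 2 * normc a ^+ 2 * normc (x k) ^+ 2 =
            2 * (normc a * normc (x k)) ^+ 2 by ring.
  by apply: le_sqr_sum => //; exact: normc_ge0.
have c0 : 0 <= 2 * normc a ^+ 2 by rewrite mulr_ge0// sqr_ge0.
rewrite esumD => [|k _|k _]; last 2 first.
- by rewrite lee_fin mulr_ge0// sqr_ge0.
- by rewrite lee_fin mulr_ge0// sqr_ge0.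
by apply: leeD; apply: le_esumZ => // k; exact: sqr_ge0.
Qed.

Lemma square_summable_submod : submod_closed square_summable.
Proof.
split=> [|a x y xs ys]; first by rewrite unfold_in /square_summable
    square_sum0 ltry.
apply: (le_lt_trans (square_sum_lin a x y)).
have c0 : 0 <= 2 * normc a ^+ 2 by rewrite mulr_ge0// sqr_ge0.
by rewrite lte_add_pinfty// lte_mul_pinfty// lee_fin.
Qed.

HB.instance Definition _ :=
  GRing.isSubmodClosed.Build R[i] (I -> R[i]) square_summable
    square_summable_submod.

Record ell2 := Ell2 { coord :> I -> R[i]; _ : square_summable coord }.

HB.instance Definition _ := [isSub for coord].
HB.instance Definition _ := [Choice of ell2 by <:].
HB.instance Definition _ := [SubChoice_isSubLmodule of ell2 by <:].

Implicit Types u v : ell2.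

Definition l2norm u : R := Num.sqrt (fine (square_sum u)).

(* [summability.sum] is the unordered sum: the limit of the partial sums along
   the directed set of finite subsets of I. *)
Definition inner u v : R[i] :=
  summability.sum (fun k => u k * (v k)^* : R[i]^o).

Lemma square_summable_delta (k : I) :
  square_summable (fun j => (j == k)%:R).
Proof.
rewrite /square_summable /square_sum.
rewrite (eq_esum (b := fun j => if j \in [set k] then 1%E else 0%E)).
  by rewrite -esum_mkcond esum_set1// ltry.
move=> j _; rewrite in_set1; case: eqP => _ /=.
  by rewrite expr0n expr1n addr0 sqrtr1 expr1n.
by rewrite expr0n addr0 sqrtr0 expr0n.
Qed.

Definition basis_vector (k : I) : ell2 := Ell2 (square_summable_delta k).

Lemma l2norm_ge0 u : 0 <= l2norm u. Proof. exact: sqrtr_ge0. Qed.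

Lemma l2norm_sqr u : ((l2norm u ^+ 2)%:E = square_sum u)%E.
Proof.
rewrite sqr_sqrtr ?fine_ge0 ?square_sum_ge0// fineK// ge0_fin_numE.
  by case: u.
exact: square_sum_ge0.
Qed.

Lemma l2norm_lin (a : R[i]) u v :
  l2norm (a *: u + v) <= 2 * (normc a * l2norm u + l2norm v).
Proof.
have a0 := normc_ge0 a; have u0 := l2norm_ge0 u; have v0 := l2norm_ge0 v.
rewrite -(@ler_pXn2r _ 2) ?nnegrE ?l2norm_ge0 ?mulr_ge0 ?addr_ge0 ?mulr_ge0//.
rewrite -lee_fin l2norm_sqr.
apply: le_trans (square_sum_lin a u v) _.
rewrite -!l2norm_sqr -!EFinM -EFinD lee_fin.
have p0 : 0 <= normc a * l2norm u by rewrite mulr_ge0.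
rewrite -mulrA -exprMn; move: p0 v0.
move: (normc a * l2norm u) (l2norm v) => p q p0 q0; nra.
Qed.

End SquareSums.

Section BoundedOperators.
Context (R : realType) (I : choiceType).
Local Notation H := (ell2 R I).

Definition bounded_operator (A : H -> H) : Prop :=
  exists M : R, forall x, l2norm (A x) <= M * l2norm x.

Record bop := Bop { bop_fun :> {linear H -> H}; _ : bounded_operator bop_fun }.

HB.instance Definition _ := gen_eqMixin bop.
HB.instance Definition _ := gen_choiceMixin bop.

Lemma bop_ext (A B : bop) : A =1 B -> A = B.
Proof.
case: A B => [A pA] [B pB] /= h.
have e : A = B.
  case: A B pA pB h => [A cA] [B cB] /= pA pB h.
  have e : A = B by apply/funext => x; exact: h.
  subst B; f_equal; clear.
  case: cA => [[a] [b]]; case: cB => [[a'] [b']].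
  by f_equal; f_equal; exact: Prop_irrelevance.
by subst B; f_equal; exact: Prop_irrelevance.
Qed.

Lemma bounded_id : bounded_operator idfun.
Proof. by exists 1 => x; rewrite mul1r. Qed.

Lemma bounded_lin (a : R[i]) (A B : bop) :
  bounded_operator (fun x => a *: A x + B x).
Proof.
case: A B => A [M AM] [B [N BN]] /=.
exists (2 * (normc a * M + N)) => x.
apply: le_trans (l2norm_lin a (A x) (B x)) _.
rewrite -mulrA ler_pM2l// mulrDl -mulrA lerD//.
by rewrite ler_wpM2l ?normc_ge0.
Qed.

Lemma bounded_zero : bounded_operator (\0 : H -> H).
Proof.
exists 0 => x; rewrite mul0r /l2norm.
by rewrite [square_sum _](_ : _ = 0%E) ?sqrtr0//; exact: square_sum0.
Qed.

Lemma bounded_comp (A B : bop) : bounded_operator (A \o B).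
Proof.
case: A B => A [M AM] [B [N BN]] /=.
exists (`|M| * N) => x /=.
apply: le_trans (AM (B x)) _.
apply: (@le_trans _ _ (`|M| * l2norm (B x))).
  by rewrite ler_wpM2r ?l2norm_ge0 ?ler_norm.
by rewrite -mulrA ler_wpM2l.
Qed.

Lemma bounded_add (A B : bop) : bounded_operator (A \+ B).
Proof.
have [M h] := bounded_lin 1 A B.
by exists M => x; have := h x; rewrite scale1r.
Qed.

Lemma bounded_scale (a : R[i]) (A : bop) : bounded_operator (a \*: A).
Proof.
have [M h] := bounded_lin a A (Bop (bop_fun := \0) bounded_zero).
by exists M => x; have := h x; rewrite /= addr0.
Qed.

Definition bop_id : bop := Bop (bop_fun := idfun) bounded_id.
Definition bop_add (A B : bop) : bop :=
  Bop (bop_fun := A \+ B) (bounded_add A B).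
Definition bop_scale (a : R[i]) (A : bop) : bop :=
  Bop (bop_fun := a \*: A) (bounded_scale a A).
Definition bop_mul (A B : bop) : bop :=
  Bop (bop_fun := A \o B) (bounded_comp A B).

(* The weak operator topology is the coarsest one making every functional
   A |-> <A x, y> continuous. *)
Definition wot : Type :=
  initial_topology (fun A : bop =>
    (fun xy : H * H => inner (A xy.1) xy.2) : {ptws H * H -> R[i]^o}).

HB.instance Definition _ := Topological.on wot.

Definition unital_subalgebra (M : set bop) : Prop :=
  [/\ M bop_id,
      forall A B, M A -> M B -> M (bop_add A B),
      forall (a : R[i]) A, M A -> M (bop_scale a A) &
      forall A B, M A -> M B -> M (bop_mul A B)].

Definition wot_closed_unital_algebra (M : set bop) : Prop :=
  unital_subalgebra M /\ closed (M : set wot).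

Definition wot_algebra (G : set bop) : set bop :=
  smallest wot_closed_unital_algebra G.

Definition commutant (M : set bop) : set bop :=
  [set A | forall B, M B -> bop_mul A B = bop_mul B A].

End BoundedOperators.

(* A word i_k ... i_1 is the sequence [:: i_k; ...; i_1], so that the words
   iw and wi are i :: w and rcons w i. *)
Notation word n := (seq 'I_n).
Notation Fock R n := (ell2 R (word n)).

Section WeightedShifts.
Context (R : realType) (n : nat).
Implicit Types (lam mu : 'I_n -> word n -> R) (T S : 'I_n -> bop R (word n)).

Definition left_weighted_shift lam T : Prop :=
  forall i w, T i (basis_vector R w) =
    (lam i w)%:C *: basis_vector R (i :: w).

Definition right_weighted_shift mu S : Prop :=
  forall i w, S i (basis_vector R w) =
    (mu i w)%:C *: basis_vector R (rcons w i).

Fixpoint weight lam (u w : word n) : R :=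
  if w is i :: w' then lam i (w' ++ u) * weight lam u w' else 1.

Definition right_weights lam (i : 'I_n) (w : word n) : R :=
  weight lam [:: i] w / weight lam [::] w.

End WeightedShifts.

(* Main.v *)
(* An operator A commutes with the left shifts T_i exactly when its matrix is
   determined by its vacuum coefficients a_u = <A xi_e, xi_u>:
   A xi_w = sum_u W(u,w) / W(e,w) a_u xi_{wu}.  The right shifts S_i are of this
   form, and such matrices are row-finite, so that commuting with A is a WOT
   closed condition expressed through finitely many coordinates at a time; hence
   R_Lambda lies in the commutant of L_Lambda.

   Conversely, given such an A, the Fejer means of its Fourier series,
   p_K = sum_{|u| < K} (1 - |u|/K) a_u (normalized product of the S_i indexed
   by u), have matrix entries (1 - (|v| - |w|)/K)_+ A_{v,w}.  Counting the
   windows of K consecutive lengths which contain both |v| and |w| shows that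
   p_K is the average K^-1 sum_m P_m A P_m, with P_m the projection on the
   lengths in the m-th window.  So |p_K x| <= |A| |x|, and boundedness together
   with coordinatewise convergence gives p_K -> A in the WOT. *)
From HB Require Import structures.
Require Import Defs.
From mathcomp Require Import all_boot all_order all_algebra complex finmap.
From mathcomp Require Import all_classical all_reals all_analysis.
From mathcomp Require Import ring lra zify.
From mathcomp Require summability.
Import numFieldNormedType.Exports.
Import Order.TTheory GRing.Theory Num.Theory.
Import ComplexField.Normc.

Set Implicit Arguments.
Unset Strict Implicit.
Unset Printing Implicit Defensive.

Local Open Scope classical_set_scope.
Local Open Scope complex_scope.
Local Open Scope ring_scope.

(** * Square-summable families and the inner product *)

#[local] Existing Instance summability.totally_filter.

Section SquareNorm.
Context (R : realType) (I : choiceType).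
Implicit Types (u v x y z : ell2 R I) (F G : {fset I}) (f : I -> R[i]).

Lemma sum_le_square_sum f F :
  ((\sum_(k <- F) normc (f k) ^+ 2)%:E <= square_sum f)%E.
Proof.
apply: esum_ge; exists [set` F]; first by split => //; exact: finite_fset.
by rewrite -fsbig_seq ?fset_uniq// sumEFin.
Qed.

Lemma square_sum_le f (C : R) :
  (forall F, \sum_(k <- F) normc (f k) ^+ 2 <= C) -> (square_sum f <= C%:E)%E.
Proof.
move=> fC; apply: ge_ereal_sup => _ [X [finX _] <-].
rewrite fsbig_finite//= sumEFin lee_fin; exact: fC.
Qed.

Lemma sum_le_normsq u F : \sum_(k <- F) normc (u k) ^+ 2 <= l2norm u ^+ 2.
Proof. by rewrite -lee_fin l2norm_sqr; exact: sum_le_square_sum. Qed.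

Lemma normsq_le u (C : R) :
  (forall F, \sum_(k <- F) normc (u k) ^+ 2 <= C) -> l2norm u ^+ 2 <= C.
Proof. by move=> uC; rewrite -lee_fin l2norm_sqr; exact: square_sum_le. Qed.

Lemma normsq_approx u (e : R) : 0 < e ->
  exists F, l2norm u ^+ 2 < \sum_(k <- F) normc (u k) ^+ 2 + e.
Proof.
move=> e0; have : ((l2norm u ^+ 2 - e)%:E < square_sum u)%E.
  by rewrite -l2norm_sqr lte_fin ltrBlDr ltrDl.
move=> /ereal_sup_gt[_ [X [finX _] <-]].
rewrite fsbig_finite//= sumEFin lte_fin ltrBlDr => h.
by exists (fset_set X).
Qed.

Lemma normc_coord_le u k : normc (u k) <= l2norm u.
Proof.
rewrite -(@ler_pXn2r _ 2) ?nnegrE ?l2norm_ge0 ?normc_ge0//.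
by apply: le_trans (sum_le_normsq u [fset k]%fset); rewrite big_seq_fset1.
Qed.

Lemma bounded_square_summable f (C : R) :
  (forall F, \sum_(k <- F) normc (f k) ^+ 2 <= C) -> square_summable f.
Proof. by move=> fC; apply: le_lt_trans (square_sum_le fC) (ltry _). Qed.

Lemma sum_fsubset (V : nmodType) (a : I -> V) F G : (F `<=` G)%fset ->
  \sum_(k <- G) a k = \sum_(k <- F) a k + \sum_(k <- (G `\` F)%fset) a k.
Proof.
move=> /fsubsetP FG.
have FE : [fset x in G | mem F x]%fset = F.
  apply/fsetP => k; rewrite !inE/=; apply/andP/idP => [[]//|kF].
  by split => //; exact: FG.
have GE : [fset x in G | ~~ mem F x]%fset = (G `\` F)%fset.
  by apply/fsetP => k; rewrite !inE/= andbC.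
by rewrite (big_fsetID _ (mem F) G) FE GE.
Qed.

Lemma normsq_tail u (e : R) : 0 < e -> exists F, forall G,
  \sum_(k <- (G `\` F)%fset) normc (u k) ^+ 2 <= e.
Proof.
move=> /(normsq_approx u)[F uF]; exists F => G.
have GFE : (G `\` F = (F `|` G) `\` F)%fset by rewrite fsetDUl fsetDv fset0U.
have := sum_le_normsq u (F `|` G)%fset.
rewrite (@sum_fsubset _ _ F) ?fsubsetUl// -GFE; lra.
Qed.

Lemma restr_square_summable (D : pred I) u :
  square_summable (fun k => if D k then u k else 0).
Proof.
apply: (@bounded_square_summable _ (l2norm u ^+ 2)) => F.
apply: le_trans (sum_le_normsq u F); apply: ler_sum => k _.
by case: ifP => // _; rewrite normc0 expr0n sqr_ge0.
Qed.

Definition restr (D : pred I) u : ell2 R I := Ell2 (restr_square_summable D u).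

Lemma normc_leD (a b : R[i]) : normc (a + b) <= normc a + normc b.
Proof. exact: le_normcD. Qed.

Lemma normc_opp (a : R[i]) : normc (- a) = normc a.
Proof. exact: normcN. Qed.

Lemma normc_conj (a : R[i]) : normc (a^*) = normc a.
Proof. by apply: complexI; rewrite -[LHS]/(`|a^*|) norm_conjC. Qed.

(** The norm of [R[i]^o] takes values in [R[i]], whose order is partial. A positive [e] there is
    real, so real tolerances suffice. *)
Lemma cvg_normcP {T : Type} {F : set_system T} {FF : Filter F}
    (g : T -> R[i]^o) (l : R[i]^o) :
  g x @[x --> F] --> l <->
  forall e : R, 0 < e -> \forall x \near F, normc (l - g x) < e.
Proof.
split=> [/cvgrPdist_lt gl e e0|gl].
  have := gl e%:C; rewrite ltcR => /(_ e0).
  by apply: filterS => x; rewrite -[X in X < _]/((normc (l - g x))%:C) ltcR.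
apply/cvgrPdist_lt => e e0.
have eE : e = (complex.Re e)%:C by rewrite RRe_real// gtr0_real.
rewrite eE ltcR in e0; have := gl _ e0.
by apply: filterS => x; rewrite eE -ltcR.
Qed.

Lemma cvg_sum_mulr {T : Type} {F : set_system T} {FF : Filter F} (s : seq I)
    (g : T -> I -> R[i]) (l c : I -> R[i]) :
  (forall k, (g x k : R[i]^o) @[x --> F] --> (l k : R[i]^o)) ->
  (\sum_(k <- s) g x k * c k : R[i]^o) @[x --> F] -->
    (\sum_(k <- s) l k * c k : R[i]^o).
Proof.
move=> gl; elim: s => [|k s IHs].
  by under eq_fun do rewrite big_nil; rewrite big_nil; exact: cvg_cst.
have glk : (g x k * c k : R[i]^o) @[x --> F] --> (l k * c k : R[i]^o).
  by apply: (@cvgMr_tmp R[i]); exact: gl.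
under eq_fun do rewrite big_cons; rewrite big_cons.
exact: (@cvgD _ R[i]^o _ _ FF _ _ _ _ glk IHs).
Qed.

Let inner_sum x y F : R[i]^o := \sum_(k <- F) x k * (y k)^*.

Lemma innerE x y : inner x y = lim (inner_sum x y @ summability.totally).
Proof.
rewrite /inner /summability.sum.
rewrite (_ : summability.partial_sum _ = inner_sum x y)//.
apply/funext => F; rewrite /inner_sum /summability.partial_sum.
by rewrite big_seq_fsetE.
Qed.

Lemma totally_above F : \forall G \near summability.totally, (F `<=` G)%fset.
Proof. by exists F. Qed.

Lemma inner_basis x k : inner x (basis_vector R k) = x k.
Proof.
rewrite innerE; apply: (@cvg_lim R[i]^o) => //.
apply: (@cvg_near_cst _ R[i]^o).
have := totally_above [fset k]%fset; apply: filterS => G.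
rewrite fsub1set => kG; rewrite /inner_sum (big_fsetD1 k)//= eqxx.
rewrite big_seq big1 ?addr0; first by rewrite conjC1 mulr1.
by move=> j; rewrite !inE => /andP[/negbTE-> _]; rewrite conjC0 mulr0.
Qed.

Lemma cvg_sum_normsq u :
  (\sum_(k <- F) (normc (u k) ^+ 2)%:C : R[i]^o)
    @[F --> summability.totally] --> ((l2norm u ^+ 2)%:C : R[i]^o).
Proof.
apply/cvg_normcP => e e0; have [F uF] := normsq_approx u e0.
have := totally_above F; apply: filterS => G FG.
rewrite -raddf_sum -raddfB/= expr0n addr0 sqrtr_sqr.
have := sum_le_normsq u G; rewrite (sum_fsubset _ FG).
have : 0 <= \sum_(k <- (G `\` F)%fset) normc (u k) ^+ 2.
  by apply: sumr_ge0 => k _; exact: sqr_ge0.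
move=> ? ?; rewrite ger0_norm; lra.
Qed.

(** Applied coordinatewise, it turns the partial sums of [inner x y] into four partial square sums,
    whose convergence is known. *)
Lemma polarization (a b : R[i]) : a * b^* = 4^-1 *
  ((normc (a + b) ^+ 2)%:C - (normc (a - b) ^+ 2)%:C
   + 'i * ((normc (a + 'i * b) ^+ 2)%:C - (normc (a - 'i * b) ^+ 2)%:C)).
Proof.
have nE (z : R[i]) : (normc z ^+ 2)%:C = z * z^*.
  by rewrite -normCK [RHS]expr2 -[X in X * _]/((normc z)%:C) -rmorphM.
have iJ : ('i : R[i])^* = - 'i by exact: conjCi.
have i2 : 'i * 'i = -1 :> R[i] by rewrite -expr2 sqrCi.
have n4 : (4 : R[i]) != 0 by rewrite pnatr_eq0.
rewrite !nE !(rmorphD, rmorphN, rmorphM)/= iJ; move: (a^*) (b^*) => a' b'.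
apply: (mulfI n4); rewrite [RHS]mulrA divff// mul1r.
(* The imaginary unit is generalized to a variable so that [ring] applies; [i * i] becomes -1
   afterwards. *)
have -> : forall i : R[i], (a + b) * (a' + b') - (a - b) * (a' - b') +
  i * ((a + i * b) * (a' + - i * b') - (a - i * b) * (a' - - i * b')) =
  2 * (a * b' + b * a') + 2 * (i * i) * (b * a' - a * b') by move=> i; ring.
by rewrite i2; ring.
Qed.

(** [lim] is informative only once a limit exists; polarization exhibits one from the norms of x ± y
    and x ± iy. *)
Lemma cvg_inner x y :
  inner_sum x y @ summability.totally --> (inner x y : R[i]^o).
Proof.
rewrite innerE; apply/cvg_ex.
pose N u : R[i]^o := (l2norm u ^+ 2)%:C.
exists (4^-1 * (N (x + y) - N (x - y)
  + 'i * (N (x + 'i *: y) - N (x - 'i *: y)))).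
rewrite [X in X @ _](_ : _ = fun F => 4^-1 * (
    \sum_(k <- F) (normc ((x + y) k) ^+ 2)%:C
    - \sum_(k <- F) (normc ((x - y) k) ^+ 2)%:C
    + 'i * (\sum_(k <- F) (normc ((x + 'i *: y) k) ^+ 2)%:C
      - \sum_(k <- F) (normc ((x - 'i *: y) k) ^+ 2)%:C)) : R[i]^o); last first.
  apply/funext => F; rewrite -!sumrB mulr_sumr -big_split/= mulr_sumr.
  by apply: eq_bigr => k _; rewrite polarization.
apply: cvgMr; apply: cvgD.
  by apply: cvgB; exact: cvg_sum_normsq.
by apply: cvgMr; apply: cvgB; exact: cvg_sum_normsq.
Qed.

(** [F] depends only on [y], [e] and [C], so it serves every [x] of the ball at once. *)
Lemma inner_tail y (e C : R) : 0 < e -> 0 < C -> exists F, forall x,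
  l2norm x ^+ 2 <= C ->
  normc (inner x y - \sum_(k <- F) x k * (y k)^*) <= e.
Proof.
(* With this weight the two AM-GM terms, [t / 2 * C] from [x] and [(2 * t)^-1 * (e * t / 2)] from
   the tail of [y], are e/4 each. *)
move=> e0 C0; pose t := e / (2 * C).
have t0 : 0 < t by rewrite divr_gt0// mulr_gt0.
have d0 : 0 < e * t / 2 by apply: divr_gt0 => //; exact: mulr_gt0.
have [F yF] := normsq_tail y d0; exists F => x xC.
apply/ler_addgt0Pr => d dpos.
have /cvg_normcP /(_ d dpos) xy := @cvg_inner x y.
have [G [{}xy FG]] := filter_ex (filterI xy (totally_above F)).
rewrite -[X in normc (X - _)](subrK (inner_sum x y G)) -addrA.
apply: le_trans (normc_leD _ _) _; rewrite [leLHS]addrC lerD ?(ltW xy)//.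
have -> : inner_sum x y G - \sum_(k <- F) x k * (y k)^* =
    \sum_(k <- (G `\` F)%fset) x k * (y k)^*.
  by rewrite /inner_sum (sum_fsubset _ FG); ring.
apply: (@le_trans _ _ (\sum_(k <- (G `\` F)%fset)
    (t / 2 * normc (x k) ^+ 2 + (2 * t)^-1 * normc (y k) ^+ 2))).
  elim/big_ind2: _ => [|a1 b1 a2 b2 h1 h2|k _].
  - by rewrite normc0.
  - by apply: le_trans (normc_leD _ _) _; rewrite lerD.
  rewrite normcM normc_conj -subr_ge0.
  (* AM-GM with weight [t] *)
  rewrite [leRHS](_ : _ = (2 * t)^-1 * (t * normc (x k) - normc (y k)) ^+ 2).
    by rewrite mulr_ge0 ?sqr_ge0// invr_ge0 mulr_ge0// ltW.
  by field; rewrite gt_eqF.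
rewrite big_split/= -!mulr_sumr.
have xG : \sum_(k <- (G `\` F)%fset) normc (x k) ^+ 2 <= C.
  exact: le_trans (sum_le_normsq _ _) xC.
apply: (@le_trans _ _ (t / 2 * C + (2 * t)^-1 * (e * t / 2))).
  apply: lerD; apply: ler_wpM2l => //.
    by rewrite divr_ge0 ?(ltW t0).
  by rewrite invr_ge0 mulr_ge0 ?(ltW t0).
rewrite {1}/t [leLHS](_ : _ = e / 2); first by rewrite ler_pdivrMr//; lra.
by field; rewrite !gt_eqF.
Qed.

(** The common bound makes the tails uniformly small; coordinatewise convergence settles the
    remaining finite sum. *)
Lemma cvg_inner_bounded (x_ : nat -> ell2 R I) x y (C : R) :
  (forall m, l2norm (x_ m) ^+ 2 <= C) ->
  (forall k, (x_ m k : R[i]^o) @[m --> \oo] --> (x k : R[i]^o)) ->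
  (inner (x_ m) y : R[i]^o) @[m --> \oo] --> (inner x y : R[i]^o).
Proof.
move=> x_C x_x; apply/cvg_normcP => e e0.
(* A positive bound valid for the squared norms of all [x_ m] and of [x] itself. *)
pose D := C + l2norm x ^+ 2 + 1.
have C0 : 0 <= C by apply: le_trans (x_C 0); exact: sqr_ge0.
have D0 : 0 < D by have := sqr_ge0 (l2norm x); rewrite /D; lra.
have e3 : 0 < e / 3 by rewrite divr_gt0.
have [F yF] := inner_tail y e3 D0.
have : inner_sum (x_ m) y F @[m --> \oo] --> inner_sum x y F.
  exact: cvg_sum_mulr.
move=> /cvg_normcP/(_ _ e3); apply: filterS => m mF.
have xF : normc (inner x y - inner_sum x y F) <= e / 3.
  by apply: yF; rewrite /D; lra.
have xmF : normc (inner (x_ m) y - inner_sum (x_ m) y F) <= e / 3.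
  by apply: yF; have := x_C m; have := sqr_ge0 (l2norm x); rewrite /D; lra.
rewrite [X in normc X](_ : _ = (inner x y - inner_sum x y F) +
  ((inner_sum x y F - inner_sum (x_ m) y F) +
   - (inner (x_ m) y - inner_sum (x_ m) y F))); last by ring.
apply: le_lt_trans (normc_leD _ _) _.
have := normc_leD (inner_sum x y F - inner_sum (x_ m) y F)
  (- (inner (x_ m) y - inner_sum (x_ m) y F)).
rewrite normc_opp => ?; lra.
Qed.

End SquareNorm.

(** * Matrix entries and the weak operator topology *)

Section Operators.
Context (R : realType) (I : choiceType).
Implicit Types (x y : ell2 R I) (A B : bop R I) (F G : {fset I}).
Local Notation basis := (basis_vector R).

Lemma bop_bound B :
  exists2 M : R, 0 <= M & forall x, l2norm (B x) <= M * l2norm x.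
Proof.
case: B => B [M BM]; exists `|M| => // x /=; apply: le_trans (BM x) _.
by rewrite ler_wpM2r ?l2norm_ge0 ?ler_norm.
Qed.

Lemma coordD x y k : (x + y) k = x k + y k. Proof. by []. Qed.

Lemma coordZ (a : R[i]) x k : (a *: x) k = a * x k. Proof. by []. Qed.

Lemma coord_sum (J : Type) (s : seq J) (f : J -> ell2 R I) (k : I) :
  (\sum_(j <- s) f j) k = \sum_(j <- s) f j k.
Proof. by elim/big_ind2: _ => // x a y b <- <-. Qed.

Lemma coord_combination F (c : I -> R[i]) k :
  (\sum_(j <- F) c j *: basis j) k = if k \in F then c k else 0.
Proof.
have E j : (c j *: basis j) k = c j * (k == j)%:R by [].
rewrite coord_sum (eq_bigr _ (fun j _ => E j)).
case: ifPn => kF.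
  rewrite (big_fsetD1 k)//= eqxx mulr1 big_seq big1 ?addr0// => j.
  by rewrite !inE eq_sym => /andP[/negbTE-> _]; rewrite mulr0.
rewrite big_seq big1// => j jF; case: eqP => [kj|_]; last by rewrite mulr0.
by rewrite kj jF in kF.
Qed.

Definition trunc F x : ell2 R I := \sum_(k <- F) x k *: basis k.

Lemma truncE F x k : trunc F x k = if k \in F then x k else 0.
Proof. exact: coord_combination. Qed.

Lemma normsq_sub_trunc x (e : R) : 0 < e ->
  exists F, l2norm (x - trunc F x) ^+ 2 <= e.
Proof.
move=> e0; have [F xF] := normsq_tail x e0; exists F; apply: normsq_le => G.
have E k : normc ((x - trunc F x) k) ^+ 2 =
    if k \notin F then normc (x k) ^+ 2 else 0.
  rewrite -[(x - trunc F x) k]/(x k - trunc F x k) truncE.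
  by case: ifP => _; rewrite ?subrr ?subr0// normc0 expr0n.
rewrite (eq_bigr _ (fun k _ => E k)) -big_mkcond/= big_fset_condE.
rewrite (_ : [fset k in G | k \notin F]%fset = (G `\` F)%fset) ?xF//.
by apply/fsetP => k; rewrite !inE/= andbC.
Qed.

(** Finite truncations of [x] are combinations of basis vectors from its support and tend to [x] in
    norm; boundedness of [B] carries the vanishing to the limit. *)
Lemma coord_eq0 B x k : (forall j, x j != 0 -> B (basis j) k = 0) -> B x k = 0.
Proof.
move=> Bx; have [M M0 BM] := bop_bound B.
suff h : normc (B x k) ^+ 2 <= 0.
  apply: eq0_normc; apply/eqP; rewrite -sqrf_eq0 eq_le h/= sqr_ge0//.
apply/ler_addgt0Pr => e e0; rewrite add0r.
have M1 : 0 < M ^+ 2 + 1 by rewrite ltr_wpDl ?sqr_ge0.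
have [F xF] := normsq_sub_trunc x (divr_gt0 e0 M1).
have -> : B x k = B (x - trunc F x) k.
  rewrite raddfB -[RHS]/(B x k - B (trunc F x) k) /trunc linear_sum coord_sum.
  rewrite big1 ?subr0// => j _; rewrite linearZ -[LHS]/(x j * B (basis j) k).
  by have [->|/Bx->] := eqVneq (x j) 0; rewrite ?mul0r ?mulr0.
apply: (@le_trans _ _ ((M * l2norm (x - trunc F x)) ^+ 2)).
  rewrite ler_pXn2r ?nnegrE ?normc_ge0 ?mulr_ge0 ?l2norm_ge0//.
  exact: le_trans (normc_coord_le _ _) (BM _).
rewrite exprMn; apply: (@le_trans _ _ (M ^+ 2 * (e / (M ^+ 2 + 1)))).
  by rewrite ler_wpM2l ?sqr_ge0.
by rewrite mulrCA ler_piMr ?(ltW e0)// ler_pdivrMr// mul1r lerDl.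
Qed.

Lemma coord_bop B F k : (forall j, j \notin F -> B (basis j) k = 0) ->
  forall x, B x k = \sum_(j <- F) x j * B (basis j) k.
Proof.
move=> BF x; have : B (x - trunc F x) k = 0.
  apply: coord_eq0 => j; rewrite -[X in X != _]/(x j - trunc F x j) truncE.
  by case: ifPn => [_|/BF//]; rewrite subrr eqxx.
rewrite raddfB -[LHS]/(B x k - B (trunc F x) k) => /eqP.
rewrite subr_eq0 => /eqP->; rewrite /trunc linear_sum coord_sum.
by apply: eq_bigr => j _; rewrite linearZ.
Qed.

Lemma bop_eqP A B : (forall j k, A (basis j) k = B (basis j) k) -> A = B.
Proof.
move=> AB; apply: bop_ext => x; apply/val_inj/funext => k /=.
apply/eqP; rewrite -subr_eq0; apply/eqP.
have := @coord_eq0 (bop_add (bop_scale (-1) B) A) x k.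
have E y : bop_add (bop_scale (-1) B) A y k = A y k - B y k.
  transitivity ((-1 *: B y + A y) k); first by [].
  by rewrite coordD coordZ mulN1r addrC.
by rewrite E => -> // j _; rewrite E AB subrr.
Qed.

(** [wot] is initial for a map into functions with the pointwise topology, itself a supremum of
    topologies induced by evaluations; so one functional can be checked at a time. *)
Lemma cvg_wot (F : set_system (bop R I)) {FF : Filter F} A :
  (forall x y, (inner (bop_fun B x) y : R[i]^o) @[B --> F] -->
    (inner (A x) y : R[i]^o)) ->
  F --> (A : wot R I).
Proof.
move=> FA U [_ [[V oV <-]] VA VU]; rewrite nbhs_filterE.
apply: filterS VU _; move: VA.
pose Phi (B : bop R I) (xy : ell2 R I * ell2 R I) : R[i]^o :=
  inner (B xy.1) xy.2.
suff : Phi @ F --> (Phi A : {ptws _ -> R[i]^o}).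
  by move=> h VA; apply: h; apply: open_nbhs_nbhs.
apply/cvg_sup => -[x y].
(* [cvg_image] asks for a surjective evaluation; constant functions provide the preimages. *)
have onto : (fun f : ell2 R I * ell2 R I -> R[i]^o => f (x, y)) @` setT = setT.
  by rewrite -subTset => z _; exists (fun=> z).
have [_ h] := cvg_image (Phi A) (fmap_filter Phi FF) onto.
apply: h => W /(FA x y) FW.
exists ((fun f : ell2 R I * ell2 R I -> R[i]^o => f (x, y)) @^-1` W) => //.
exact: image_preimage.
Qed.

Lemma wot_inner_continuous x y :
  continuous (fun A : wot R I => inner (bop_fun A x) y : R[i]^o).
Proof.
move=> A; apply: (@continuous_comp (wot R I) _ _
  (fun A : wot R I =>
    (fun xy => inner (bop_fun A xy.1) xy.2) : {ptws _ -> R[i]^o})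
  (proj (x, y))).
  exact: initial_continuous.
exact: proj_continuous.
Qed.

Lemma wot_coord_continuous x k :
  continuous (fun A : wot R I => bop_fun A x k : R[i]^o).
Proof.
under [X in continuous X]eq_fun do rewrite -inner_basis.
exact: wot_inner_continuous.
Qed.

(** Makes each coordinate of [B (A x)] a finite sum of coordinates of [A x], hence WOT continuous in
    [A], without passing to the adjoint of [B]. *)
Definition row_finite B :=
  forall k, exists F, forall j, j \notin F -> B (basis j) k = 0.

Lemma row_finite_commutant B : row_finite B ->
  wot_closed_unital_algebra [set A | bop_mul A B = bop_mul B A].
Proof.
move=> Bfin; split.
  split => [|A1 A2 h1 h2|a A h|A1 A2 h1 h2] /=; apply: bop_ext => x /=.
  - by [].
  - by rewrite linearD; congr (_ + _);
      [have := congr1 (fun C => bop_fun C x) h1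
      |have := congr1 (fun C => bop_fun C x) h2].
  - by rewrite linearZ; congr (_ *: _); have := congr1 (fun C => bop_fun C x) h.
  - have /= E2 := congr1 (fun C => bop_fun C x) h2.
    by have /= <- := congr1 (fun C => bop_fun C (A2 x)) h1; rewrite E2.
have [F BF] := choice Bfin.
(* A matrix entry of AB - BA, with BA expanded along a finite row of [B]. The commutant is the
   intersection of the closed zero sets of these WOT continuous functions. *)
pose D (p : I * I) (A : wot R I) : R[i]^o :=
  bop_fun A (B (basis p.1)) p.2 -
  \sum_(j <- F p.2) bop_fun A (basis p.1) j * B (basis j) p.2.
rewrite [X in closed X](_ : _ = \bigcap_(p in setT) (D p @^-1` [set 0])).
  apply: closed_bigI => p _; apply: preimage_closed; last first.
    apply: accessible_closed_set1; apply: hausdorff_accessible.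
    exact: norm_hausdorff.
  move=> A _; have h1 := @wot_coord_continuous (B (basis p.1)) p.2 A.
  have h2 :
      (\sum_(j <- F p.2) bop_fun A' (basis p.1) j * B (basis j) p.2 : R[i]^o)
      @[A' --> (A : wot R I)] -->
      (\sum_(j <- F p.2) bop_fun A (basis p.1) j * B (basis j) p.2 : R[i]^o).
    apply: (@cvg_sum_mulr _ _ _ _ (nbhs_filter (A : wot R I))) => k.
    exact: wot_coord_continuous.
  exact: (@cvgB _ R[i]^o _ _ (nbhs_filter (A : wot R I)) _ _ _ _ h1 h2).
apply/seteqP; split => A /= h.
  move=> [i k] _ /=; rewrite /D /= -(coord_bop (BF k)).
  by have /= -> := congr1 (fun C => bop_fun C (basis i)) h; rewrite subrr.
apply: bop_eqP => i k /=; rewrite (coord_bop (BF k)).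
by have /eqP := h (i, k) Logic.I; rewrite subr_eq0 => /eqP.
Qed.

End Operators.

(** * Weighted shifts along an injection, and existence of the right shifts *)

Section WeightedShiftOperator.
Context (R : realType) (I : choiceType).
Context (phi : I -> I) (psi : I -> option I) (c : I -> R) (C : R).
Context (phiK : pcancel phi psi) (psiK : ocancel psi phi).
Context (c_le : forall k, `|c k| <= C).

Definition weighted_coord (x : ell2 R I) k : R[i] :=
  if psi k is Some j then (c j)%:C * x j else 0.

(** [psi] is injective where defined, so pulling [F] back along it gives a list without repetitions,
    over which the squares of [x] sum to at most its squared norm. *)
Lemma weighted_coord_sum x (F : {fset I}) :
  \sum_(k <- F) normc (weighted_coord x k) ^+ 2 <= C ^+ 2 * l2norm x ^+ 2.
Proof.
pose g j := normc ((c j)%:C * x j) ^+ 2.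
have -> : \sum_(k <- F) normc (weighted_coord x k) ^+ 2 =
    \sum_(j <- pmap psi F) g j.
  elim: (enum_fset F) => [|k s IHs]; first by rewrite !big_nil.
  rewrite big_cons IHs [pmap _ (k :: s)]/= /weighted_coord.
  case: (psi k) => [j|]; first by rewrite [oapp _ _ _]/= big_cons.
  by rewrite normc0 expr0n add0r.
have u : uniq (pmap psi F) by apply: pmap_uniq (fset_uniq F).
rewrite -[in X in X <= _](undup_id u).
apply: le_trans (_ : _ <= C ^+ 2 * \sum_(j <- pmap psi F) normc (x j) ^+ 2) _.
  rewrite undup_id// mulr_sumr; apply: ler_sum => j _.
  rewrite /g normcM exprMn ler_wpM2r ?sqr_ge0//.
  rewrite -[normc _]/(Num.sqrt (c j ^+ 2 + 0 ^+ 2)) expr0n addr0 sqrtr_sqr.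
  by rewrite ler_pXn2r ?nnegrE// (le_trans _ (c_le j)).
rewrite ler_wpM2l ?sqr_ge0//.
have -> : \sum_(j <- pmap psi F) normc (x j) ^+ 2 =
    \sum_(j <- [fset j in pmap psi F]%fset) normc (x j) ^+ 2.
  by apply: perm_big; apply: uniq_perm => // j; rewrite !inE.
exact: sum_le_normsq.
Qed.

Definition weighted_fun x : ell2 R I :=
  Ell2 (bounded_square_summable (weighted_coord_sum x)).

Lemma weighted_fun_linear : linear weighted_fun.
Proof.
move=> a x y; apply/val_inj/funext => k /=.
rewrite -[RHS]/(a * weighted_coord x k + weighted_coord y k) /weighted_coord.
case: (psi k) => [j|]; last by rewrite mulr0 addr0.
by rewrite coordD coordZ mulrDr mulrCA.
Qed.

HB.instance Definition _ :=
  GRing.isLinear.Build R[i] (ell2 R I) (ell2 R I) *:%R weighted_fun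
    weighted_fun_linear.

Lemma weighted_fun_bounded : bounded_operator weighted_fun.
Proof.
exists `|C| => x; rewrite -(@ler_pXn2r _ 2) ?nnegrE ?mulr_ge0 ?l2norm_ge0//.
rewrite exprMn real_normK ?num_real//.
by apply: normsq_le => F; exact: weighted_coord_sum.
Qed.

Definition weighted_bop : bop R I :=
  Bop (bop_fun := weighted_fun) weighted_fun_bounded.

Lemma weighted_bop_basis k :
  weighted_bop (basis_vector R k) = (c k)%:C *: basis_vector R (phi k).
Proof.
apply/val_inj/funext => j.
transitivity (weighted_coord (basis_vector R k) j) => //.
transitivity ((c k)%:C * (j == phi k)%:R) => //.
rewrite /weighted_coord /=; have := psiK j.
case psij : (psi j) => [l|] /= => [<-|_].
  by rewrite (inj_eq (pcan_inj phiK)); case: eqP => [->|]; rewrite ?mulr0.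
case: eqP => [jk|_]; last by rewrite mulr0.
by rewrite jk phiK in psij.
Qed.

End WeightedShiftOperator.

Section RightShift.
Context (R : realType) (n : nat).

Lemma right_weighted_shift_exists (mu : 'I_n -> word n -> R) (C : R) :
  (forall i w, `|mu i w| <= C) ->
  exists S : 'I_n -> bop R (word n), right_weighted_shift mu S.
Proof.
move=> muC.
(* Deletes a final letter [i]: the partial inverse of [rcons^~ i]. *)
pose psi i (v : word n) :=
  if v is j :: w then (if last j w == i then Some (belast j w) else None)
  else None.
have phiK i : pcancel (rcons^~ i) (psi i).
  by move=> [|j w] /=; rewrite ?eqxx// last_rcons eqxx belast_rcons.
have psiK i : ocancel (psi i) (rcons^~ i).
  move=> [|j w] //=; case: eqP => //= <-; by rewrite -lastI.
exists (fun i => weighted_bop (psiK i) (muC i)) => i w.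
exact: weighted_bop_basis (phiK i) _ _ _.
Qed.

End RightShift.

(** * The commutant of a left weighted shift *)

Section LeftShiftCommutant.
Context (R : realType) (n : nat) (lam : 'I_n -> word n -> R).
Context (lam_gt0 : forall i w, 0 < lam i w).
Context (T : 'I_n -> bop R (word n)) (shiftT : left_weighted_shift lam T).
Implicit Types (A B : bop R (word n)) (v w u : word n).
Local Notation basis := (basis_vector R).

Definition commutes_with_shift A : Prop :=
  forall i, bop_mul A (T i) = bop_mul (T i) A.

Lemma weight_gt0 u w : 0 < weight lam u w.
Proof. by elim: w => [|i w IHw] /=; rewrite ?ltr01 ?mulr_gt0. Qed.

Lemma shift_basis i w v : T i (basis w) v = (lam i w)%:C * (v == i :: w)%:R.
Proof. by rewrite shiftT. Qed.

Lemma shift_coord_nil i x : T i x [::] = 0.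
Proof. by apply: coord_eq0 => w _; rewrite shift_basis mulr0. Qed.

Lemma shift_coord_cons i j v x :
  T i x (j :: v) = if j == i then (lam i v)%:C * x v else 0.
Proof.
rewrite (@coord_bop _ _ _ [fset v]%fset) => [|w]; last first.
  rewrite inE shift_basis eqseq_cons eq_sym => /negbTE->.
  by rewrite andbF mulr0.
rewrite big_seq_fset1 shift_basis eqseq_cons eqxx andbT.
by case: eqP; rewrite ?mulr0 ?mulr1// mulrC.
Qed.

Lemma shift_row_finite i : row_finite (T i).
Proof.
(* Only [w = behead v] can satisfy [v = i :: w]; for empty [v] the whole row is zero. *)
move=> v; exists [fset behead v]%fset => w; rewrite inE shift_basis => wv.
by case: eqP => [vE|_]; rewrite ?mulr0//; rewrite vE eqxx in wv.
Qed.

Lemma commutes_step A i w v : commutes_with_shift A ->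
  A (basis (i :: w)) v = ((lam i w)^-1)%:C * T i (A (basis w)) v.
Proof.
move=> /(_ i) /(congr1 (fun B => bop_fun B (basis w))) /= <-.
rewrite shiftT linearZ coordZ mulrA -rmorphM/= mulVf ?mul1r//.
by rewrite gt_eqF.
Qed.

(** Each letter of [w] is pulled out by A xi_{iw} = lambda_{i,w}^-1 T_i A xi_w. As T_i puts its
    letter in front, an entry survives only if v = wu, and the collected factors are W(u,w) /
    W(e,w). *)
Lemma commutes_coord A w v : commutes_with_shift A ->
  A (basis w) v =
  if take (size w) v == w then
    (weight lam (drop (size w) v) w / weight lam [::] w)%:C
      * A (basis [::]) (drop (size w) v)
  else 0.
Proof.
move=> cA; elim: w v => [|i w IHw] v.
  by rewrite take0 drop0 eqxx /= divr1 mul1r.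
rewrite commutes_step//; case: v => [|j v] /=.
  by rewrite shift_coord_nil mulr0.
rewrite shift_coord_cons eqseq_cons eq_sym.
case: eqP => [_|] /=; last by rewrite mulr0.
rewrite IHw; case: eqP => [wv|_]; last by rewrite !mulr0.
have vE : w ++ drop (size w) v = v by rewrite -{1}wv cat_take_drop.
rewrite !mulrA -!rmorphM/= cats0 vE.
congr (_%:C * _); have := weight_gt0 [::] w; have := lam_gt0 i w => ? ?.
by field; rewrite !gt_eqF.
Qed.

Definition prefixes v : {fset word n} :=
  [fset take m v | m in iota 0 (size v).+1]%fset.

Lemma take_prefixes v w : take (size w) v = w -> w \in prefixes v.
Proof.
move=> wv; apply/imfsetP; exists (size w) => //.
rewrite -[_ \in _]/(size w \in iota 0 (size v).+1).
by rewrite mem_iota add0n ltnS /= -wv size_take_min geq_minr.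
Qed.

Lemma commutes_prefixes A v w : commutes_with_shift A -> w \notin prefixes v ->
  A (basis w) v = 0.
Proof.
move=> cA; rewrite commutes_coord//.
by case: eqP => // /take_prefixes ->.
Qed.

Lemma commutes_row_finite A : commutes_with_shift A -> row_finite A.
Proof. by move=> cA v; exists (prefixes v) => w; exact: commutes_prefixes. Qed.

Lemma commutes_with_shift_algebra : unital_subalgebra commutes_with_shift.
Proof.
have h i := (row_finite_commutant (shift_row_finite i)).1.
split => [i|A B cA cB i|a A cA i|A B cA cB i]; have [h1 h2 h3 h4] := h i.
- exact: h1.
- exact: h2.
- exact: h3.
- exact: h4.
Qed.

(** Both products send xi_w to multiples of xi_{jwi}, and these agree because W(i,jw) =
    lambda_{j,wi} W(i,w) and W(e,jw) = lambda_{j,w} W(e,w). *)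
Lemma right_shift_commutes S : right_weighted_shift (right_weights lam) S ->
  forall i, commutes_with_shift (S i).
Proof.
move=> shiftS i j; apply: bop_eqP => w v /=.
rewrite shiftT shiftS !linearZ !coordZ shiftT shiftS !coordZ rcons_cons.
rewrite !mulrA -!rmorphM/=; congr (_%:C * _).
rewrite /right_weights /= cats0 cats1.
have := weight_gt0 [::] w; have := lam_gt0 j w => ? ?.
by field; rewrite !gt_eqF.
Qed.

(** By minimality of [wot_algebra]: the commutant of the row-finite [T i] is a WOT closed unital
    algebra containing the generators. *)
Lemma wot_algebra_commutant (S : 'I_n -> bop R (word n)) :
  (forall i, commutes_with_shift (S i)) ->
  wot_algebra (range S) `<=` commutes_with_shift.
Proof.
move=> cS A SA i.
apply: (SA [set B | bop_mul B (T i) = bop_mul (T i) B]); split.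
  exact: row_finite_commutant (shift_row_finite i).
by move=> _ [j _ <-]; exact: cS.
Qed.

(** The same minimality with roles exchanged: [A] is row-finite too, its row at [v] being supported
    on the prefixes of [v]. *)
Lemma commutes_commutant A : commutes_with_shift A ->
  commutant (wot_algebra (range T)) A.
Proof.
move=> cA B TB; apply/esym.
apply: (TB [set B | bop_mul B A = bop_mul A B]); split.
  exact: row_finite_commutant (commutes_row_finite cA).
by move=> _ [i _ <-] /=; rewrite cA.
Qed.

Lemma commutant_commutes A :
  commutant (wot_algebra (range T)) A -> commutes_with_shift A.
Proof. by move=> cA i; apply: cA => M [_]; apply; exists i. Qed.

End LeftShiftCommutant.

(** * Fejer means *)

Section FejerMeans.
Context (R : realType).

Lemma normc_real (r : R) : normc r%:C = `|r|.
Proof. by rewrite /= expr0n addr0 sqrtr_sqr. Qed.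

(** Cauchy-Schwarz against the constant sequence 1. The induction step divides by [k], so [k = 0] is
    treated apart. *)
Lemma sqr_normc_sum (k : nat) (z : nat -> R[i]) :
  normc (\sum_(j < k) z j) ^+ 2 <= k%:R * \sum_(j < k) normc (z j) ^+ 2.
Proof.
elim: k => [|k IHk]; first by rewrite !big_ord0 normc0 expr0n mulr0.
rewrite !big_ord_recr.
set s := \sum_(j < k) z j; set q := \sum_(j < k) normc (z j) ^+ 2.
apply: (@le_trans _ _ ((normc s + normc (z k)) ^+ 2)).
  by rewrite ler_pXn2r ?nnegrE ?addr_ge0 ?normc_ge0// normc_leD.
have {}IHk : normc s ^+ 2 <= k%:R * q by [].
have q0 : 0 <= q by apply: sumr_ge0 => j _; exact: sqr_ge0.
have [k0|k0] := posnP k.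
  move: IHk; rewrite k0 mul0r => IHk.
  have s0 : normc s = 0.
    by apply/eqP; rewrite -sqrf_eq0 eq_le IHk sqr_ge0.
  by rewrite s0 add0r /= mul1r lerDr.
have kR : 0 < k%:R :> R by rewrite ltr0n.
rewrite -natr1 mulrDl mul1r mulrDr sqrrD.
move: (normc s) (normc (z k)) (k%:R : R) IHk kR => a b K IHk kR /=.
suff : a * b *+ 2 <= K * b ^+ 2 + q by lra.
have : 0 <= K^-1 * (K * b - a) ^+ 2 by rewrite mulr_ge0 ?sqr_ge0 ?invr_ge0 ?ltW.
have -> : K^-1 * (K * b - a) ^+ 2 = K * b ^+ 2 - a * b *+ 2 + a ^+ 2 / K.
  by field; rewrite gt_eqF.
have : a ^+ 2 / K <= q by rewrite ler_pdivrMr// mulrC.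
lra.
Qed.

Lemma sum_window (V : nmodType) (K d : nat) (a : V) :
  \sum_(j < K) (if (d + j < K)%N then a else 0) = a *+ (K - d).
Proof.
elim: K d => [|K IHK] d; first by rewrite big_ord0 sub0n mulr0n.
have [dK|dK] := ltnP K d.
  rewrite big1 => [|j _]; last by rewrite ifF//; lia.
  by rewrite (_ : _ - _ = 0)%N ?mulr0n//; lia.
rewrite big_ord_recl /= addn0 ltnS dK.
rewrite (eq_bigr (fun j : 'I_K => if (d + j < K)%N then a else 0)) => [|j _].
  by rewrite IHK -mulrS subSn.
by rewrite /bump /= add1n addnS ltnS.
Qed.

Lemma sum_window_le (N s K : nat) (a : R) : 0 <= a ->
  \sum_(m < N) (if (s <= m)%N && (m < s + K)%N then a else 0) <= K%:R * a.
Proof.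
move=> a0.
(* The difference of minima counts the integers of [s, s + K) below N. *)
have -> : \sum_(m < N) (if (s <= m)%N && (m < s + K)%N then a else 0) =
    a *+ (minn N (s + K) - minn N s).
  elim: N => [|N IHN]; first by rewrite big_ord0 !min0n subnn mulr0n.
  rewrite big_ord_recr /= IHN; case: ifP => h.
    by rewrite -mulrSr; congr (_ *+ _); lia.
  by rewrite addr0; congr (_ *+ _); lia.
by rewrite -[leLHS]mulr_natl ler_wpM2r// ler_nat; lia.
Qed.

Lemma sum_shift_le (N s K : nat) (a : nat -> R) : (forall m, 0 <= a m) ->
  (s + K <= N)%N -> \sum_(j < K) a (s + j)%N <= \sum_(m < N) a m.
Proof.
move=> a0 sKN.
have -> : \sum_(j < K) a (s + j)%N = \sum_(s <= m < s + K) a m.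
  rewrite -{2}[s]add0n big_addn addKn big_mkord.
  by apply: eq_bigr => j _; rewrite addnC.
have sN : (s <= N)%N := leq_trans (leq_addr K s) sKN.
rewrite -(big_mkord xpredT a) (big_cat_nat (leq0n s) sN)/=.
rewrite (big_cat_nat (leq_addr K s) sKN)/=.
by rewrite ler_wpDl ?sumr_ge0// lerDl sumr_ge0.
Qed.

Context (n : nat) (lam : 'I_n -> word n -> R).
Context (lam_gt0 : forall i w, 0 < lam i w).
Context (T : 'I_n -> bop R (word n)) (shiftT : left_weighted_shift lam T).
Implicit Types (A B p : bop R (word n)) (u v w : word n).
Local Notation basis := (basis_vector R).
Local Notation commutes := (commutes_with_shift T).

(** The lengths m - K + 1, ..., m, written additively so that [m < K] causes no truncated
    subtraction. *)
Definition window (K m : nat) : pred (word n) :=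
  fun w => (size w <= m)%N && (m < size w + K)%N.

(** A length lies in at most K windows, so each coordinate of [x] is counted at most K times. *)
Lemma sum_normsq_window (K N : nat) (x : Fock R n) :
  \sum_(m < N) l2norm (restr (window K m) x) ^+ 2 <= K%:R * l2norm x ^+ 2.
Proof.
rewrite -lee_fin -sumEFin EFinM.
under eq_bigr do rewrite l2norm_sqr.
rewrite -esum_sum => [|w m _ _]; last by rewrite lee_fin sqr_ge0.
rewrite l2norm_sqr.
apply: le_trans
  (@le_esumZ R (word n) K%:R (fun w => normc (x w) ^+ 2) _ _) => //;
  last by move=> w; exact: sqr_ge0.
apply: le_esum => w _; rewrite sumEFin lee_fin.
rewrite (eq_bigr (fun m : 'I_N => if (size w <= m)%N && (m < size w + K)%N
  then normc (x w) ^+ 2 else 0)) => [|m _].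
  exact: sum_window_le (sqr_ge0 _).
by rewrite /= /window; case: ifP => // _; rewrite normc0 expr0n.
Qed.

(* The truncated subtraction makes this (1 - d/K)_+. *)
Definition fejer (K d : nat) : R := (K - d)%:R / K%:R.

(* Exactly K - (|v| - |w|) of the K windows containing |v| also contain |w|. *)
Lemma fejer_coord A p (K : nat) x v : (0 < K)%N -> commutes A -> commutes p ->
  (forall w v',
    p (basis w) v' = (fejer K (size v' - size w))%:C * A (basis w) v') ->
  K%:R * p x v = \sum_(j < K) A (restr (window K (size v + j)) x) v.
Proof.
move=> K0 cA cp pA.
have rowA := commutes_prefixes lam_gt0 shiftT cA.
rewrite (coord_bop (fun w => commutes_prefixes lam_gt0 shiftT cp)).
under [RHS]eq_bigr do rewrite (coord_bop (rowA v)).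
rewrite exchange_big mulr_sumr; apply: eq_bigr => w _.
have [Aw|Aw] := eqVneq (A (basis w) v) 0.
  rewrite pA Aw !mulr0 big1// => j _; by rewrite mulr0.
(* A nonzero entry forces [w] to be a prefix of [v], so [size v - size w] is a true difference. The
   windows containing |v| have index [size v + j] with [j < K]. *)
have wv : (size w <= size v)%N.
  move: Aw; rewrite (commutes_coord lam_gt0 shiftT _ _ cA).
  case: (take (size w) v =P w) => [<- _|_]; rewrite ?eqxx//.
  by rewrite size_take_min geq_minr.
rewrite pA -mulr_suml /= (eq_bigr (fun j : 'I_K =>
  if (size v - size w + j < K)%N then x w else 0)) => [|j _].
  rewrite sum_window /fejer rmorphM fmorphV !rmorph_nat -mulr_natl.
  have : K%:R != 0 :> R[i] by rewrite pnatr_eq0 -lt0n.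
  by move=> ?; field.
congr (if _ then _ else _); rewrite /window /=.
have wvj : (size w <= size v + j)%N := leq_trans wv (leq_addr _ _).
by rewrite wvj addnBAC// ltn_subLR.
Qed.

(** Cauchy-Schwarz on the window average bounds |(p x)_v|^2 by K^-1 sum_m |(A P_m x)_v|^2. Summing
    over [v] first leaves the norms of A P_m x, and the P_m overlap at most K times. *)
Lemma fejer_norm_le A p (K : nat) (M : R) x : (0 < K)%N ->
  commutes A -> commutes p -> 0 <= M ->
  (forall y, l2norm (A y) <= M * l2norm y) ->
  (forall w v,
    p (basis w) v = (fejer K (size v - size w))%:C * A (basis w) v) ->
  l2norm (p x) ^+ 2 <= M ^+ 2 * l2norm x ^+ 2.
Proof.
move=> K0 cA cp M0 AM pA; apply: normsq_le => G.
have KR : 0 < K%:R :> R by rewrite ltr0n.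
pose a v m := normc (A (restr (window K m) x) v) ^+ 2.
have a0 v m : 0 <= a v m by exact: sqr_ge0.
(* Large enough for [m < N] to cover all windows meeting the length of any [v] in [G]. *)
pose N := (\sum_(v <- G) size v + K)%N.
apply: (@le_trans _ _ (K%:R^-1 * \sum_(v <- G) \sum_(m < N) a v m)).
  rewrite mulr_sumr big_seq [leRHS]big_seq; apply: ler_sum => v vG.
  have vN : (size v + K <= N)%N.
    by rewrite /N leq_add2r (big_fsetD1 v vG)/= leq_addr.
  apply: (@le_trans _ _ (K%:R^-1 * \sum_(j < K) a v (size v + j)%N)); last first.
    by rewrite ler_wpM2l ?invr_ge0 ?ler0n// sum_shift_le.
  have := sqr_normc_sum K (fun j => A (restr (window K (size v + j)) x) v).
  rewrite -(fejer_coord x v K0 cA cp pA) normcM -(rmorph_nat (real_complex R)).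
  rewrite normc_real normr_nat exprMn => h.
  by rewrite ler_pdivlMl// -(ler_pM2l KR) mulrA -expr2.
rewrite exchange_big/= ler_pdivrMl//.
apply: (@le_trans _ _
  (\sum_(m < N) M ^+ 2 * l2norm (restr (window K m) x) ^+ 2)).
  apply: ler_sum => m _; apply: le_trans (sum_le_normsq _ _) _.
  by rewrite -exprMn ler_pXn2r ?nnegrE ?mulr_ge0 ?l2norm_ge0.
by rewrite -mulr_sumr mulrCA ler_wpM2l ?sqr_ge0// sum_normsq_window.
Qed.

Lemma fejer_cvg (d : nat) (z : R[i]) :
  ((fejer k.+1 d)%:C * z : R[i]^o) @[k --> \oo] --> (z : R[i]^o).
Proof.
apply/cvg_normcP => e e0.
have z0 := normc_ge0 z.
near=> k.
have kR : 0 < k.+1%:R :> R by rewrite ltr0n.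
have dk : (d <= k.+1)%N by apply: leqW; near: k; exact: nbhs_infty_ge.
rewrite -[X in X - _]mul1r -mulrBl -(rmorph1 (real_complex R)) -rmorphB.
rewrite normcM normc_real /fejer.
have -> : 1 - (k.+1 - d)%:R / k.+1%:R = d%:R / k.+1%:R :> R.
  by rewrite natrB//; field; rewrite gt_eqF.
rewrite ger0_norm ?divr_ge0// mulrAC ltr_pdivrMr//.
have : d%:R * normc z / e < k%:R.
  by near: k; exact: nbhs_infty_gtr.
rewrite ltr_pdivrMr// => h; apply: lt_le_trans h _.
by rewrite mulrC ler_pM2l// ler_nat.
Unshelve. all: by end_near.
Qed.

(** * Polynomials in the right shifts with prescribed vacuum image *)

Section Polynomials.
Context (mu : 'I_n -> word n -> R) (mu_gt0 : forall i w, 0 < mu i w).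
Context (S : 'I_n -> bop R (word n)) (shiftS : right_weighted_shift mu S).
Context (M : set (bop R (word n))) (algM : unital_subalgebra M).
Context (MS : forall i, M (S i)).

(** [S j] appends [j] on the right, hence the induction on the last letter; positivity of the weight
    allows normalizing. *)
Lemma polynomial_basis u : exists2 p, M p & p (basis [::]) = basis u.
Proof.
have [M1 _ MZ MM] := algM.
elim/last_ind: u => [|u j [p Mp pu]]; first by exists (bop_id R (word n)).
exists (bop_scale ((mu j u)^-1)%:C (bop_mul (S j) p)).
  by apply: MZ; exact: MM.
rewrite /= pu shiftS scalerA -rmorphM/= mulVf ?scale1r//.
by rewrite gt_eqF.
Qed.

Lemma polynomial_combination (s : seq (word n)) (c : word n -> R[i]) :
  exists2 p, M p & p (basis [::]) = \sum_(u <- s) c u *: basis u.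
Proof.
have [M1 MD MZ MM] := algM.
elim: s => [|u s [p Mp ps]].
  exists (bop_scale 0 (bop_id R (word n))); first exact: MZ.
  by rewrite big_nil /= scale0r.
have [q Mq qu] := polynomial_basis u.
exists (bop_add (bop_scale (c u) q) p); first by apply: MD => //; exact: MZ.
by rewrite big_cons /= qu ps.
Qed.

End Polynomials.

Definition words_upto (k : nat) : {fset word n} :=
  [fset val t | t in {: k.-bseq 'I_n}]%fset.

Lemma words_uptoP k w : (w \in words_upto k) = (size w <= k)%N.
Proof.
apply/imfsetP/idP => [[t _ ->]|wk]; first exact: size_bseq.
by exists (Bseq wk).
Qed.

(** An operator commuting with the shifts is fixed by its vacuum image, so [p] is prescribed only
    there; |v| - |w| is the length of u in v = wu. *)
Lemma fejer_exists (S : 'I_n -> bop R (word n)) (M : set (bop R (word n))) A K :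
  right_weighted_shift (right_weights lam) S ->
  unital_subalgebra M -> (forall i, M (S i)) -> commutes A ->
  exists p, [/\ M p, commutes p & forall w v,
    p (basis w) v = (fejer K (size v - size w))%:C * A (basis w) v].
Proof.
move=> shiftS algM MS cA.
pose N := M `&` commutes.
have algN : unital_subalgebra N.
  have [M1 MD MZ MM] := algM.
  have [C1 CD CZ CM] := commutes_with_shift_algebra shiftT.
  by split; [split|move=> ? ? [? ?] [? ?]; split; [exact: MD|exact: CD]
    |move=> ? ? [? ?]; split; [exact: MZ|exact: CZ]
    |move=> ? ? [? ?] [? ?]; split; [exact: MM|exact: CM]].
have cS := right_shift_commutes lam_gt0 shiftT shiftS.
have NS i : N (S i) by split.
have mu_gt0 i w : 0 < right_weights lam i w.
  by rewrite divr_gt0 ?weight_gt0.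
have [p [Mp cp] p0] := polynomial_combination mu_gt0 shiftS algN NS
  (words_upto K) (fun u => (fejer K (size u))%:C * A (basis [::]) u).
exists p; split => // w v.
rewrite (commutes_coord lam_gt0 shiftT _ _ cp).
rewrite (commutes_coord lam_gt0 shiftT _ _ cA) p0 coord_combination.
case: ifP => _; last by rewrite mulr0.
(* Words longer than [K] are absent from the combination, where the truncated weight is 0 as
   well. *)
rewrite words_uptoP size_drop; case: leqP => [_|Kv]; first by rewrite mulrCA.
by rewrite /fejer (eqP (ltnW Kv)) mul0r mul0r mulr0.
Qed.

(** The Fejer means lie in the closed set [M], share the bound of [A], and converge in each
    coordinate, a finite sum over prefixes; so their WOT limit [A] is in [M]. *)
Lemma commutes_mem (S : 'I_n -> bop R (word n)) (M : set (bop R (word n))) A :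
  right_weighted_shift (right_weights lam) S ->
  wot_closed_unital_algebra M -> (forall i, M (S i)) -> commutes A -> M A.
Proof.
move=> shiftS [algM closedM] MS cA.
(* The index [k.+1] keeps the window width positive. *)
have /choice[p_ pP] := fun k => fejer_exists k.+1 shiftS algM MS cA.
have [B B0 AB] := bop_bound A.
have pA : p_ @ \oo --> (A : wot R (word n)).
  apply: cvg_wot => x y.
  apply: (@cvg_inner_bounded _ _ (fun k => p_ k x) _ _
    (B ^+ 2 * l2norm x ^+ 2)).
    move=> k; have [_ cp pE] := pP k.
    exact: (fejer_norm_le x (ltn0Sn k) cA cp).
  move=> v; have rowA := @commutes_prefixes _ _ _ lam_gt0 _ shiftT.
  have pE k : p_ k x v = \sum_(w <- prefixes v)
      (fejer k.+1 (size v - size w))%:C * A (basis w) v * x w.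
    have [_ cp pkE] := pP k; rewrite (coord_bop (fun w => rowA (p_ k) v w cp)).
    by apply: eq_bigr => w _; rewrite pkE mulrC.
  have AE : A x v = \sum_(w <- prefixes v) A (basis w) v * x w.
    rewrite (coord_bop (fun w => rowA A v w cA)).
    by apply: eq_bigr => w _; rewrite mulrC.
  under eq_fun do rewrite pE.
  by rewrite AE; apply: cvg_sum_mulr => w; exact: fejer_cvg.
apply: (@closed_cvg _ (wot R (word n)) _ _ _ M closedM _ _ pA).
by apply: nearW => k; have [] := pP k.
Qed.

End FejerMeans.

Theorem corollary2p5 (R : realType) (n : nat) (n_ge2 : (2 <= n)%N)
    (lam : 'I_n -> word n -> R) (lam_gt0 : forall i w, 0 < lam i w)
    (T : 'I_n -> bop R (word n)) (shiftT : left_weighted_shift lam T)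
    (sup_finite :
       (ereal_sup [set (weight lam [:: i] w * (weight lam [::] w)^-1)%:E
                  | i in [set: 'I_n] & w in [set: word n]] < +oo)%E) :
  (exists S : 'I_n -> bop R (word n),
     right_weighted_shift (right_weights lam) S) /\
  (forall S : 'I_n -> bop R (word n),
     right_weighted_shift (right_weights lam) S ->
     commutant (wot_algebra (range T)) = wot_algebra (range S)).
Proof.
have [C muC] : exists C : R, forall i w, `|right_weights lam i w| <= C.
  move: sup_finite; set s := ereal_sup _ => s_lt.
  have le_s i w : ((right_weights lam i w)%:E <= s)%E.
    by apply: ereal_sup_ubound; exists i => //; exists w.
  (* [fine s] is the actual supremum: [s_lt] excludes +oo and [le_s] excludes -oo. *)
  exists (fine s) => i w; have := le_s i w.
  rewrite ger0_norm; last by rewrite divr_ge0// ltW ?weight_gt0.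
  by move: s_lt; case: s {le_s} => [r| |].
split=> [|S shiftS]; first exact: right_weighted_shift_exists muC.
have cS := right_shift_commutes lam_gt0 shiftT shiftS.
apply/seteqP; split => A.
  move=> /commutant_commutes cA M [Malg MS].
  apply: (commutes_mem lam_gt0 shiftT shiftS Malg _ cA) => i.
  by apply: MS; exists i.
move=> /(wot_algebra_commutant shiftT cS) cA.
exact: (commutes_commutant lam_gt0 shiftT cA).
Qed.
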